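(* Let $a\ge2$ and $0\le b<a$ be integers and run the golden sieve on $W_0=a\mathbb{N}+b$, with survivor sequence $(s_n)$ and deletion sequence $(d_n)$. (i) Survivors. $(s_n)$ is a $(0,s_1,2a,a)$-hiccup sequence. Explicitly, for every $n\ge2$, $$s_n-s_{n-1}=\begin{cases}2a & \text{if } n\in\{s_1,s_2,\ldots\},\\ a & \text{if } n\notin\{s_1,s_2,\ldots\}.\end{cases}$$ (ii) Deletions. The deletion gaps take exactly the two values $a(a+1)$ and $a(2a+1)$, and for every $n\ge2$, $$d_n-d_{n-1}=\begin{cases}a(2a+1) & \text{if } n\in W_0\setminus\{d_1,d_2,\ldots\},\\ a(a+1) & \text{otherwise.}\end{cases}$$ Since $W_0=\{s_k\}\sqcup\{d_k\}$, the test $n\in W_0\setminus\{d_k\}$ is equivalent to $n\in\{s_1,s_2,\ldots\}$. (When $a=1$ and $W_0=\mathbb{N}$, this deletion rule reduces to the rule: for $n\ge2$, $d_n-d_{n-1}=2$ if $n\in\{d_k\}$ and $d_n-d_{n-1}=3$ if $n\notin\{d_k\}$.) Both gap sequences are encoded by the single binary word $H(n):=\mathbf{1}_{n\in\{s_1,s_2,\ldots\}}\in\{0,1\}$, in the sense that for $n\ge2$, $s_n-s_{n-1}=a(1+H(n))$ and $d_n-d_{n-1}=a\bigl(a(1+H(n))+1\bigr)$.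
   Context: $\mathbb{N}=\{1,2,3,\ldots\}$ and $a\mathbb{N}+b=\{an+b:n\ge1\}$, viewed as an increasing sequence. For a strictly increasing sequence $X$ of positive integers, $X(k)$ denotes its $k$-th term; $\mathbf{1}$ denotes an indicator; $\sqcup$ denotes disjoint union. Golden sieve: let $W_0=(w_1<w_2<\cdots)$ be an infinite strictly increasing sequence of positive integers. For $n\ge1$ define inductively $h_n:=W_{n-1}(n)$ (the pointer), $d_n:=W_{n-1}(h_n)$ (the deletion), and let $W_n$ be the increasing sequence obtained from $W_{n-1}$ by removing the value $d_n$. The survivor sequence $(s_n)_{n\ge1}$ is the increasing enumeration of $W_0\setminus\{d_1,d_2,\ldots\}$. Hiccup sequences: let $y,z$ be distinct positive integers, $x\ge0$ and $j\ge0$ integers. An increasing sequence $(x_n)_{n\ge1}$ of integers with $x_1=x$ is a $(j,x,y,z)$-hiccup sequence if for every $n\ge2$, $x_n-x_{n-1}=y$ if $n-j\in\{x_1,\ldots,x_{n-1}\}$ and $x_n-x_{n-1}=z$ otherwise. *)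

(* Defs.v *)
From mathcomp Require Import all_boot all_order all_algebra.
From mathcomp Require Import boolp classical_sets.
Set Implicit Arguments.
Unset Strict Implicit.
Unset Printing Implicit Defensive.
Import Order.TTheory GRing.Theory Num.Theory.
Local Open Scope classical_set_scope.
Local Open Scope nat_scope.

(* A sequence (x_n)_{n >= 1} is a function on nat whose value at 0 is
   irrelevant: no notion below depends on it. *)

Definition terms (X : nat -> nat) : set nat := [set X k | k in [set k | 1 <= k]].

Definition strictly_increasing (X : nat -> nat) : Prop :=
  forall i k, 1 <= i -> i < k -> X i < X k.

Definition increasing_enumeration (X : nat -> nat) (A : set nat) : Prop :=
  strictly_increasing X /\ terms X = A.

(* Gaps are taken in int, so that the subtraction is not truncated. *)
Definition gap (X : nat -> nat) (n : nat) : int := ((X n)%:Z - (X n.-1)%:Z)%R.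

(* For X strictly increasing having v as a term, this is the increasing
   sequence of the other terms of X (see remove_valueP). *)
Definition remove_value (v : nat) (X : nat -> nat) : nat -> nat :=
  fun k => if X k < v then X k else X k.+1.

Lemma remove_valueP (v : nat) (X : nat -> nat) :
  strictly_increasing X -> v \in terms X ->
  increasing_enumeration (remove_value v X) (terms X `\ v).
Proof.
move=> incX /set_mem[m /= m1 <-]; rewrite /remove_value.
have ltX i k : 1 <= i -> 1 <= k -> (X i < X k) = (i < k).
  move=> i1 k1; case: (ltngtP i k) => [ik|ki|->]; last by rewrite ltnn.
    by rewrite incX.
  by apply/negbTE; rewrite -leqNgt ltnW // incX.
split=> [i k i1 ik|].
  have k1 : 1 <= k by apply: leq_trans (ltnW ik).
  rewrite !ltX //; case: ifPn => im; case: ifPn => km; rewrite ltX //.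
    exact: ltnW.
  by move: im; rewrite -leqNgt => /leq_trans/(_ (ltnW ik)); rewrite leqNgt km.
apply/seteqP; split=> [_ [k /= k1 <-]|_ [[k /= k1 <-] kNm]].
  rewrite ltX //; case: ltnP => km; split.
  - by exists k.
  - by move=> /= E; have := ltX k m k1 m1; rewrite E ltnn km.
  - by exists k.+1.
  - by move=> /= E; have := ltX m k.+1 m1 isT; rewrite E ltnn ltnS km.
case: (ltngtP k m) => [km|mk|E].
- by exists k => //=; rewrite ltX // km.
- case: k mk {k1 kNm} => // k mk; exists k; first exact: leq_trans m1 mk.
  rewrite ltX //; first by rewrite ltnNge -ltnS mk.
  exact: leq_trans m1 mk.
- by case: kNm; rewrite E.
Qed.

(* sieve W0 n is W_n: since h_n = W_{n-1}(n), the value removed is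
   d_n = W_{n-1}(W_{n-1}(n)). *)
Fixpoint sieve (W0 : nat -> nat) (n : nat) : nat -> nat :=
  if n is m.+1 then
    let W := sieve W0 m in remove_value (W (W m.+1)) W
  else W0.

Definition pointer (W0 : nat -> nat) (n : nat) : nat := sieve W0 n.-1 n.

Definition deletion (W0 : nat -> nat) (n : nat) : nat :=
  sieve W0 n.-1 (pointer W0 n).

Definition survivor_sequence (W0 s : nat -> nat) : Prop :=
  increasing_enumeration s (terms W0 `\` terms (deletion W0)).

Definition hiccup (j x y z : nat) (X : nat -> int) : Prop :=
  [/\ y != z, 0 < y & 0 < z] /\
  [/\ forall i k, 1 <= i -> i < k -> (X i < X k)%R,
      X 1 = Posz x
    & forall n, 2 <= n ->
        (X n - X n.-1)%R =
          if (n%:Z - j%:Z)%R \in [set X i | i in [set i | 1 <= i < n]]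
          then Posz y else Posz z].

(* The sequence a N + b, with N = {1, 2, 3, ...}. *)
Definition progression (a b : nat) : nat -> nat := fun n => a * n + b.

Definition deletion_rule (a : nat) (W0 d : nat -> nat) : Prop :=
  forall n, 2 <= n ->
    gap d n = if n \in terms W0 `\` terms d
              then Posz (a * (2 * a + 1)) else Posz (a * (a + 1)).

Definition deletion_rule_N (d : nat -> nat) : Prop :=
  forall n, 2 <= n -> gap d n = if n \in terms d then Posz 2 else Posz 3.

Definition survivor_word (s : nat -> nat) (n : nat) : nat := n \in terms s.

(* Main.v *)
(** Let [h_n], [d_n] and [W_n] be the pointers, deletions and stages of the
    sieve. As [h] is strictly increasing and [d_n] is the term of index [h_n]
    of [W_(n-1)], the terms of index at least [h_n] are only ever shifted by
    one at each earlier step: [d_n = W_0(h_n + n - 1)], and [s_k = W_0(k + m)]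
    where [m] is the number of pointers at most [k]. For [W_0 = aN + b] this
    gives [s_n - s_(n-1) = a (1 + [n is a pointer])] and
    [d_n - d_(n-1) = a (h_n - h_(n-1) + 1)]. Finally [h_n = W_(n-1)(n)] is
    never moved again once [n < h_n], so that [h_n = s_n]; the only failure is
    [h_1 = 1] for [W_0 = N]. *)

Require Import Defs.
From mathcomp Require Import all_boot all_order all_algebra.
From mathcomp Require Import boolp classical_sets.
From mathcomp Require Import zify.
Import Order.TTheory GRing.Theory Num.Theory.
Local Open Scope classical_set_scope.
Local Open Scope nat_scope.

(** * Strictly increasing sequences and uniqueness of increasing enumerations *)

Lemma strictly_increasing_ltn X : strictly_increasing X ->
  forall i k, 1 <= i -> 1 <= k -> (X i < X k) = (i < k).
Proof.
move=> incX i k i1 k1; case: (ltngtP i k) => [ik|ki|->]; last by rewrite ltnn.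
  by rewrite incX.
by apply/negbTE; rewrite -leqNgt ltnW // incX.
Qed.

Lemma strictly_increasing_leq X : strictly_increasing X ->
  forall i k, 1 <= i -> 1 <= k -> (X i <= X k) = (i <= k).
Proof.
by move=> incX i k i1 k1; rewrite leqNgt (strictly_increasing_ltn _ incX) // -leqNgt.
Qed.

Lemma strictly_increasing_ge X : strictly_increasing X -> 1 <= X 1 ->
  forall k, 1 <= k -> k <= X k.
Proof.
move=> incX X1; elim=> // -[|k] IH _ //.
exact: leq_ltn_trans (IH isT) (incX k.+1 k.+2 isT (ltnSn _)).
Qed.

Lemma increasing_enumeration_uniq X Y A :
  increasing_enumeration X A -> increasing_enumeration Y A ->
  forall k, 1 <= k -> X k = Y k.
Proof.
suff H U V : increasing_enumeration U A -> increasing_enumeration V A ->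
    forall k, 1 <= k -> (forall i, 1 <= i < k -> U i = V i) -> U k <= V k.
  move=> hX hY; elim/ltn_ind=> k IH k1; have E i : 1 <= i < k -> X i = Y i.
    by case/andP=> i1 ik; exact: IH.
  by apply/eqP; rewrite eqn_leq (H X Y) // (H Y X) // => i ik; rewrite E.
(* [V k] is some term [U m]; if [m < k], agreement below [k] would give [V m = V k], against
   strictness. *)
move=> [incU tU] [incV tV] k k1 E.
have [m /= m1 Em] : terms U (V k) by rewrite tU -tV; exists k.
rewrite -Em (strictly_increasing_leq _ incU) //; case: (leqP k m) => // mk.
by have := incV m k m1 mk; rewrite -Em -E ?m1 ?mk // ltnn.
Qed.

(** * The sieve on an arbitrary increasing sequence of positive integers *)

Section Sieve.
Variable W0 : nat -> nat.
Hypotheses (incW : strictly_increasing W0) (W1 : 1 <= W0 1).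
Local Notation W := (sieve W0).
Local Notation h := (pointer W0).
Local Notation d := (deletion W0).

(** The diagonal of the stages: since [k < h k.+1], every removal after stage [k] happens beyond
    index [k], so the term of index [k] is final there. *)
Definition survivors (k : nat) : nat := W k k.

Lemma sieve_increasing n : strictly_increasing (W n) /\ 1 <= W n 1.
Proof.
elim: n => [|n [inc pos]] //; split.
  have hn : 1 <= W n n.+1.
    exact: leq_trans (strictly_increasing_ge _ inc pos n.+1 isT).
  apply: (proj1 (remove_valueP inc _)); rewrite inE.
  by exists (W n n.+1).
rewrite /= /remove_value; case: ifP => // _.
exact: leq_trans pos (ltnW (inc 1 2 isT isT)).
Qed.

Lemma sieve_ge n k : 1 <= k -> k <= W n k.
Proof. by case: (sieve_increasing n) => *; exact: strictly_increasing_ge. Qed.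

Lemma pointer_ge n : 1 <= n -> n <= h n.
Proof. by move=> n1; exact: sieve_ge. Qed.

(** [remove_value] compares values; the removed one has index [h n.+1] in the increasing [W n], so
    indices can be compared instead. *)
Lemma sieveS n k : 1 <= k ->
  W n.+1 k = if k < h n.+1 then W n k else W n k.+1.
Proof.
move=> k1; rewrite /= /remove_value /pointer /=.
have [inc _] := sieve_increasing n.
by rewrite (strictly_increasing_ltn _ inc) // (leq_trans _ (sieve_ge n n.+1 _)).
Qed.

Lemma terms_sieveS n : terms (W n.+1) = terms (W n) `\ d n.+1.
Proof.
have [inc _] := sieve_increasing n.
apply: (proj2 (remove_valueP inc _)); rewrite inE.
by exists (W n n.+1) => //=; exact: leq_trans (sieve_ge n n.+1 isT).
Qed.

Lemma pointer_ltS n : 1 <= n -> h n < h n.+1.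
Proof.
case: n => // n _; rewrite -[X in _ < X]/(W n.+1 n.+2).
have [inc _] := sieve_increasing n.
have lt1 : W n n.+1 < W n n.+2 by exact: inc.
rewrite sieveS //; case: ifP => // _.
exact: ltn_trans lt1 (inc n.+2 n.+3 isT (ltnSn _)).
Qed.

Lemma pointer_increasing : strictly_increasing h.
Proof.
move=> i k i1; elim: k => // k IH; rewrite ltnS leq_eqVlt => /orP[/eqP<-|ik].
  exact: pointer_ltS.
by rewrite (ltn_trans (IH ik)) // pointer_ltS // (leq_trans i1 (ltnW ik)).
Qed.

Lemma sieve_above n k : 1 <= k -> (1 <= n -> h n <= k) -> W n k = W0 (k + n).
Proof.
elim: n k => [|n IH] k k1 hk; first by rewrite addn0.
rewrite sieveS // ltnNge hk //= IH ?addSnnS // => n1.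
exact: leq_trans (ltnW (pointer_ltS n n1)) (leq_trans (hk isT) (leqnSn k)).
Qed.

Lemma deletionE n : 1 <= n -> d n = W0 (h n + n.-1).
Proof.
case: n => // n _; apply: sieve_above => [|n1].
  exact: leq_trans (pointer_ge n.+1 isT).
exact: ltnW (pointer_ltS n n1).
Qed.

(** The removals after stage [m] occur at indices at least [h m.+1], hence beyond [k]. *)
Lemma sieve_below m n k : m <= n -> 1 <= k < h m.+1 -> W n k = W m k.
Proof.
move=> mn /andP[k1 km]; elim: n mn => [|n IH].
  by rewrite leqn0 => /eqP->.
rewrite leq_eqVlt => /orP[/eqP<-//|mn]; rewrite sieveS // IH // ifT //.
by apply: leq_trans km _; rewrite (strictly_increasing_leq _ pointer_increasing).
Qed.

Lemma survivorsE m k : 1 <= k < h m.+1 -> survivors k = W m k.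
Proof.
move=> km; have [mk|/ltnW mk] := leqP m k; first exact: sieve_below.
rewrite (sieve_below k m k) //; case/andP: km => -> _ /=.
exact: pointer_ge.
Qed.

Lemma survivors_shift m k : 1 <= k < h m.+1 -> (1 <= m -> h m <= k) ->
  survivors k = W0 (k + m).
Proof.
move=> km hm; rewrite (survivorsE m) // sieve_above //.
by case/andP: km.
Qed.

(** This [m] counts the pointers at most [k]. It is taken as the least [m] with [k < h m.+1];
    minimality gives [h m <= k]. *)
Lemma pointer_bracket k : exists m, k < h m.+1 /\ (1 <= m -> h m <= k).
Proof.
have ex : exists m, k < h m.+1 by exists k; exact: pointer_ge.
exists (ex_minn ex); case: ex_minnP => m km min; split=> //.
case: m km min => // m _ min _; rewrite leqNgt; apply/negP => /min.
by rewrite ltnn.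
Qed.

(** The shift of a survivor is its pointer count, and passing from [n.-1] to [n] raises this count
    exactly when [n] is itself a pointer. *)
Lemma survivors_step n : 2 <= n -> exists m,
  survivors n.-1 = W0 (n.-1 + m) /\
  survivors n = W0 (n + m + (n \in terms h)).
Proof.
case: n => [|[|n]] // _; have [m [nm hm]] := pointer_bracket n.+2.
case: (boolP (n.+2 \in terms h)) => [/set_mem[i /= i1 Ei]|/negP Nt].
  (* The bracket around a pointer [h i] is [h i] itself; the index before [n] then has one pointer
     fewer, which explains the predecessor given as witness. *)
  have ? : m = i.
    apply/eqP; rewrite eqn_leq -ltnS; apply/andP; split.
      case: m hm {nm} => // m /(_ isT).
      by rewrite -Ei ltnS (strictly_increasing_leq _ pointer_increasing).
    by rewrite -ltnS -(strictly_increasing_ltn _ pointer_increasing) // Ei.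
  subst i; case: m i1 Ei nm hm => // m _ Ei nm hm.
  exists m; rewrite (survivors_shift m) /= ?Ei ?ltnSn //; last first.
    by move=> m1; rewrite -ltnS -Ei pointer_ltS.
  by rewrite (survivors_shift m.+1) ?addn1 ?addnS ?nm.
exists m; rewrite addn0 /= (survivors_shift m n.+1) ?(ltnW nm) //; last first.
  move=> m1; rewrite -ltnS ltn_neqAle hm // andbT; apply/eqP => E.
  by apply: Nt; rewrite inE; exists m.
by split=> //; rewrite (survivors_shift m) ?nm.
Qed.

Lemma terms_sieve n x :
  terms (W n) x <-> terms W0 x /\ forall i, 1 <= i <= n -> d i <> x.
Proof.
elim: n => [|n IH].
  by split=> [|[]//]; split=> // i; case: i.
rewrite terms_sieveS; split=> [[/= /IH[Wx dx] xd]|[Wx dx]].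
  split=> // i /andP[i1]; rewrite leq_eqVlt => /orP[/eqP->|ilt] E.
    exact: xd.
  by apply: (dx i) => //; rewrite i1.
split=> /=; last by move=> E; apply: (dx n.+1); rewrite //= leqnn.
by apply/IH; split=> // i /andP[i1 le]; apply: dx; rewrite i1 leqW.
Qed.

Lemma survivors_enumeration : survivor_sequence W0 survivors.
Proof.
split.
  move=> i k i1 ik.
  have -> : survivors i = W k i.
    by rewrite (sieve_below i) ?(ltnW ik) // i1 pointer_ge.
  by case: (sieve_increasing k) => + _; apply.
apply/seteqP; split=> [_ [k /= k1 <-]|x [Wx dx]].
  split; first by have /terms_sieve[] : terms (W k) (W k k) by exists k.
  move=> [i /= i1 Ei].
  (* Stage [i + k] is late enough both for [d i] to be gone and for the term of index [k] to be
     final. *)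
  have E : survivors k = W (i + k) k.
    by rewrite (sieve_below k) ?leq_addl // k1 pointer_ge.
  have /terms_sieve[_ /(_ i)] : terms (W (i + k)) (survivors k).
    by rewrite E; exists k.
  by rewrite i1 leq_addr => /(_ isT).
(* A value [x] never deleted is still in stage [x], at some index [k]. As [k <= W x k = x], that
   stage comes after the term of index [k] has settled. *)
have : terms (W x) x.
  by apply/terms_sieve; split=> // i /andP[i1 _] E; apply: dx; exists i.
move=> [k /= k1 Ek]; exists k => //=.
rewrite -[RHS]Ek (sieve_below k) //; last by rewrite k1 pointer_ge.
by rewrite -[X in _ <= X]Ek sieve_ge.
Qed.

Lemma deletion_terms n : 1 <= n -> terms W0 (d n).
Proof.
move=> n1; exists (h n + n.-1); last by rewrite deletionE.
by rewrite /= addn_gt0 (leq_trans n1 (pointer_ge n n1)).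
Qed.

Lemma pointer_survivors n : n < h n -> 1 <= n -> h n = survivors n.
Proof.
by case: n => // n nh _; rewrite (survivorsE n).
Qed.

(** Strict growth of [h] propagates the bound from [n = 2]. There, either [2 < h 1] already, or the
    first removal shifts index 2 and [h 2 = W0 3]. *)
Lemma pointer_gt n : 2 <= n -> n < h n.
Proof.
elim: n => // -[//|[_ _|n IH _]]; last first.
  by rewrite (leq_ltn_trans (IH isT)) // pointer_ltS.
case: (ltnP 2 (h 1)) => [h1|h1]; first exact: ltn_trans h1 (pointer_ltS 1 isT).
rewrite [h 2](_ : _ = W 1 2) // sieveS // ifN -?leqNgt //.
exact: (strictly_increasing_ge _ incW W1 3).
Qed.

End Sieve.

(** * Arithmetic progressions *)

Section Progression.
Variables a b : nat.
Hypothesis a0 : 0 < a.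
Local Notation W0 := (progression a b).
Local Notation h := (pointer W0).
Local Notation d := (deletion W0).

Lemma progression_increasing : strictly_increasing W0.
Proof. by move=> i k _ ik; rewrite /progression ltn_add2r ltn_pmul2l. Qed.

Lemma progression_gt0 : 1 <= W0 1.
Proof. by rewrite /progression muln1 addn_gt0 a0. Qed.

Lemma survivors_progression_step n : 2 <= n ->
  survivors W0 n = survivors W0 n.-1 + a * (1 + (n \in terms h)).
Proof.
move=> n2.
have [m [-> ->]] :=
  survivors_step W0 progression_increasing progression_gt0 n n2.
rewrite /progression; nia.
Qed.

Lemma deletion_progression n : 1 <= n -> d n = a * (h n + n.-1) + b.
Proof.
exact: (deletionE W0 progression_increasing progression_gt0).
Qed.

Lemma pointer_progression n : 2 <= n -> h n = survivors W0 n.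
Proof.
move=> n2; apply: pointer_survivors (ltnW n2).
- exact: progression_increasing.
- exact: progression_gt0.
- exact: (pointer_gt _ progression_increasing progression_gt0).
Qed.

End Progression.

(** Only index 1 needs [2 <= a]: it makes [h 1 = a + b] exceed 1. *)
Lemma pointer_progression_ge2 a b n : 2 <= a -> 1 <= n ->
  pointer (progression a b) n = survivors (progression a b) n.
Proof.
move=> a2; case: n => // -[_|n _]; last exact: (pointer_progression a b (ltnW a2) n.+2).
apply: pointer_survivors => //.
- exact: progression_increasing (ltnW a2).
- exact: progression_gt0 (ltnW a2).
- by rewrite /pointer /= /progression; lia.
Qed.

(** * The case of the natural numbers, [a = 1] and [b = 0] *)

Lemma deletion_rule_naturals e :
  deletion_rule 1 (progression 1 0) e <-> deletion_rule_N e.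
Proof.
suff H n : 2 <= n ->
    (n \in terms (progression 1 0) `\` terms e) = (n \notin terms e).
  by split=> E n n2; rewrite E // H //; case: (n \in terms e).
(* Every [n] is a term here, so the test becomes non-membership in [e] and the two branches swap. *)
move=> n2; apply/idP/negP => [/set_mem[_ ne] /set_mem//|ne].
rewrite inE; split=> [|/mem_set//]; exists n; first exact: ltnW.
by rewrite /progression mul1n addn0.
Qed.

Lemma deletion_naturals : deletion_rule_N (deletion (progression 1 0)).
Proof.
set W := progression 1 0 => n n2.
have inc : strictly_increasing W by exact: progression_increasing.
have pos : 1 <= W 1 by [].
have [incs ts] := survivors_enumeration W inc pos.
have E : (n \in terms (deletion W)) = (n \notin terms (survivors W)).
  rewrite ts; apply/idP/negP => [/set_mem dn /set_mem[]//|nd].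
  rewrite inE; apply: contrapT => dn; apply: nd; rewrite inE; split=> //.
  by exists n; [exact: ltnW | rewrite /W /progression mul1n addn0].
have h1 : pointer W 1 = 1 by [].
have s1 : survivors W 1 = 2 by [].
case: n n2 E => [|[|n]] // _ E.
have dn m : 1 <= m -> deletion W m = pointer W m + m.-1.
  by move=> m1; rewrite deletion_progression // mul1n addn0.
rewrite /gap !dn //=.
(* The value 2 is treated apart: it is the first survivor but not a pointer, the pointers starting
   with 1 and 3. *)
case: n E => [|n] E.
  have -> : (2 \in terms (deletion W)) = false.
    by apply/negbTE; rewrite E negbK inE; exists 1.
  by rewrite h1.
have := survivors_progression_step 1 0 isT n.+3 isT.
rewrite -/W /= -!pointer_progression // -/W.
(* Pointers and survivors differ only in their first terms, 1 and 2, so they agree as sets from 3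
   on. *)
have -> : (n.+3 \in terms (pointer W)) = ~~ (n.+3 \in terms (deletion W)).
  rewrite E negbK; apply/idP/idP => /set_mem[[|[|m]] //= _ Em]; rewrite inE;
    exists m.+2 => //; rewrite -Em; first exact/esym/pointer_progression.
  exact/pointer_progression.
case: (n.+3 \in terms (deletion W)); lia.
Qed.

Theorem theorem3p14 (a b : nat) (ha : 2 <= a) (hb : b < a) :
  let W0 := progression a b in
  let d := deletion W0 in
  (exists s, survivor_sequence W0 s) /\
  (forall s, survivor_sequence W0 s ->
    let H := survivor_word s in
    (hiccup 0 (s 1) (2 * a) a (fun n => Posz (s n)) /\
     (forall n, 2 <= n ->
        gap s n = if n \in terms s then Posz (2 * a) else Posz a)) /\
    ([set gap d n | n in [set n | 2 <= n]] =
       [set Posz (a * (a + 1)); Posz (a * (2 * a + 1))] /\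
     deletion_rule a W0 d) /\
    (terms W0 = terms s `|` terms d /\ terms s `&` terms d = set0 /\
     (forall n, (n \in terms W0 `\` terms d) = (n \in terms s))) /\
    (forall n, 2 <= n ->
       gap s n = Posz (a * (1 + H n)) /\
       gap d n = Posz (a * (a * (1 + H n) + 1)))) /\
  ((forall e : nat -> nat,
      deletion_rule 1 (progression 1 0) e <-> deletion_rule_N e) /\
   deletion_rule_N (deletion (progression 1 0))).

Proof.
move=> W0 d; set t := survivors W0; set h := pointer W0.
have a0 : 0 < a := ltnW ha.
have inc : strictly_increasing W0 by exact: progression_increasing.
have pos : 1 <= W0 1 by exact: progression_gt0.
have tP : survivor_sequence W0 t by exact: survivors_enumeration.
split; first by exists t.
split; last by split; [exact: deletion_rule_naturals|exact: deletion_naturals].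
move=> s sP H; have [incs ts] := sP.
(* By uniqueness, any enumeration [s] is the diagonal one, except at the meaningless index 0. *)
have st n : 1 <= n -> s n = t n.
  exact: (increasing_enumeration_uniq _ _ _ sP tP).
have hs n : 1 <= n -> h n = s n.
  by move=> n1; rewrite st // /h pointer_progression_ge2.
have hs_terms : terms h = terms s.
  by apply/seteqP; split=> _ [k /= k1 <-]; exists k; rewrite //= hs.
have s_step n : 2 <= n -> s n = s n.-1 + a * (1 + H n).
  case: n => [|[|n]] // n2; rewrite !st //.
  by rewrite [LHS]survivors_progression_step // -/h hs_terms.
have d_step n : 2 <= n -> d n = d n.-1 + a * (a * (1 + H n) + 1).
  case: n => [|[|n]] // n2; rewrite /d !deletion_progression // -/W0 -/h.
  rewrite !hs // (s_step n.+2) //=; nia.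
have gap_s n : 2 <= n -> gap s n = Posz (a * (1 + H n)).
  by move=> n2; rewrite /gap (s_step n n2) PoszD addrC addKr.
have gap_d n : 2 <= n -> gap d n = Posz (a * (a * (1 + H n) + 1)).
  by move=> n2; rewrite /gap (d_step n n2) PoszD addrC addKr.
have gap_s_if n : 2 <= n ->
    gap s n = if n \in terms s then Posz (2 * a) else Posz a.
  by move=> n2; rewrite gap_s // /H /survivor_word; case: ifP => _; lia.
have s_gt n : 1 <= n -> n < s n.
  move=> n1; rewrite -hs //; case: n n1 => [|[|n]] // _.
    by rewrite /h /pointer /= /W0 /progression; lia.
  exact: pointer_gt.
have mem n : (n \in terms W0 `\` terms d) = (n \in terms s) by rewrite ts.
have drule : deletion_rule a W0 d.
  by move=> n n2; rewrite gap_d // mem /H /survivor_word; case: ifP => _; lia.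
split.
  split=> //; split; first by split; lia.
  split=> // n n2; rewrite subr0.
  rewrite [LHS]gap_s_if //.
  (* The hiccup test only sees indices below [n]; this loses nothing, since [s i = n] forces [i < n]
     by [s_gt]. *)
  suff -> : (Posz n \in [set Posz (s i) | i in [set i | 1 <= i < n]]) =
            (n \in terms s) by [].
  apply/idP/idP => /set_mem[i /=].
    by move=> /andP[i1 _] [<-]; rewrite inE; exists i.
  by move=> i1 Ei; rewrite inE; exists i; rewrite ?Ei //= i1 -Ei s_gt.
split.
  split=> //; apply/seteqP; split=> [_ [n /= n2 <-]|_ [->|->]].
  - by rewrite drule //; case: ifP => _; [right|left].
  (* Each gap value is attained at an index of the matching kind: the small one at the deleted
     number [d 1], the large one at the survivor [s 1]. *)
  - have d1 : 2 <= d 1.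
      rewrite /d deletion_progression //= addn0 -/W0 -/h hs //.
      by have := s_gt 1 isT; nia.
    exists (d 1) => //; rewrite drule // ifF //; apply/negbTE/negP.
    by move=> /set_mem[_]; apply; exists 1.
  - exists (s 1); first exact: s_gt.
    by rewrite drule ?s_gt // mem ifT // inE; exists 1.
split; last by split; [exact: gap_s | exact: gap_d].
split; last split=> //.
  rewrite ts; apply/seteqP; split=> [x Wx|x [[]//|[k /= k1 <-]]].
    by case: (pselect (terms d x)) => ?; [right|left].
  exact: deletion_terms.
by rewrite ts; apply/seteqP; split=> // x [[]].
Qed.
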